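(* Assume that the Lagrangians $L_1,\dots,L_N$ satisfy (A1) and (A2) (stated in the context). Then the semi-Lagrangian scheme is monotone: given two bounded discrete functions $v_1,v_2:J^{\Delta x}\to\mathbb{R}$ with $v_1\le v_2$, one has $$S[\hat v_1](x)\le S[\hat v_2](x)\qquad\text{for all } x\in J^{\Delta x}.$$
   Context: Junction: fix $N\ge1$ and distinct unit vectors $e_1,\dots,e_N$; $J_i=\{k e_i: k\ge 0\}$ (isometric to $[0,+\infty)$), $J=\bigcup_{i=1}^N J_i$, with $J_i\cap J_j=\{0\}$ for $i\ne j$. For $x=ke_i$ write $|x|=k$, and $L_i(x,\alpha)$ means $L_i(|x|,\alpha)$. Assumptions: (A1) the functions $L_i:[0,\infty)\times\mathbb{R}\to\mathbb{R}$ are strictly convex with respect to the second argument and uniformly Lipschitz continuous; (A2) $L_i(x,\alpha)/|\alpha|\to+\infty$ as $|\alpha|\to+\infty$, uniformly in $x\in[0,\infty)$. A constant $\bar L_0\in\mathbb{R}$ is the running cost for staying at the junction point. Scheme operator: given $\Delta t,\Delta x>0$, $J^{\Delta x}=\bigcup_i\{k\Delta x\,e_i:k\in\mathbb{N}\}$ (with $0\in J^{\Delta x}$). $\mathbb{I}[\hat v](z)$, $z\in J$, is the continuous piecewise linear (on each arc) interpolation of the grid values $\hat v=\{v(x)\}_{x\in J^{\Delta x}}$. For $x\in J^{\Delta x}\cap(J_i\setminus\{0\})$, $S[\hat v](x)=\min(\mathcal I_1,\mathcal I_2)$ with $$\mathcal I_1=\inf_{\alpha_i<|x|/\Delta t}\big\{\mathbb{I}[\hat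 v](x-\alpha_i\Delta t\,e_i)+\Delta t\,L_i(x,\alpha_i)\big\},$$ $$\mathcal I_2=\inf_{\alpha_i\ge |x|/\Delta t}\ \inf_{s_0\in[0,\Delta t-|x|/\alpha_i]}\ \inf_{j\in\{1,\dots,N\},\,\alpha_j\le0}\Big\{\mathbb{I}[\hat v](-\theta\alpha_je_j)+\theta L_j(0,\alpha_j)+s_0\bar L_0+\tfrac{|x|}{\alpha_i}L_i(x,\alpha_i)\Big\},\quad \theta=\Delta t-s_0-\tfrac{|x|}{\alpha_i},$$ and $$S[\hat v](0)=\inf_{s_0\in[0,\Delta t]}\ \inf_{j,\,\alpha_j\le0}\big\{\mathbb{I}[\hat v](-(\Delta t-s_0)\alpha_je_j)+(\Delta t-s_0)L_j(0,\alpha_j)+s_0\bar L_0\big\}.$$ (In $\mathcal I_2$ the control $\alpha_j$ is chosen independently of $\alpha_i$, also when $j=i$.) *)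

(* Defs.v *)
From HB Require Import structures.
From mathcomp Require Import all_boot all_order all_algebra.
From mathcomp Require Import all_classical all_reals all_analysis.
Set Implicit Arguments.
Unset Strict Implicit.
Unset Printing Implicit Defensive.
Import Order.TTheory GRing.Theory Num.Theory.
Import numFieldNormedType.Exports.
Local Open Scope classical_set_scope.
Local Open Scope ring_scope.

Section Lagrangian.
Variables (R : realType) (L : R -> R -> R).

(* [L x a] is the running cost at distance [x >= 0] from the vertex under the
   control [a]; its values at [x < 0] are never used and never constrained. *)

(* A superlinear function of [a] cannot be Lipschitz on the whole real line, so
   the Lipschitz condition bears on [x], with a constant that is uniform over
   bounded sets of controls. This is implied by Lipschitz continuity in [x]
   uniformly in all controls, and by joint Lipschitz continuity for bounded
   controls. *)
Definition regular_lagrangian :=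
  (forall x, 0 <= x -> forall a b t : R, a != b -> 0 < t -> t < 1 ->
     L x (t * a + (1 - t) * b) < t * L x a + (1 - t) * L x b) /\
  (forall M : R, exists K : R, forall a x y : R,
     `|a| <= M -> 0 <= x -> 0 <= y -> `|L x a - L y a| <= K * `|x - y|).

Definition superlinear_lagrangian :=
  forall A : R, exists2 M : R, 0 < M &
    forall x a : R, 0 <= x -> M <= `|a| -> A <= L x a / `|a|.

End Lagrangian.

Section Junction.
Variables (R : realType) (V : normedModType R) (N : nat) (e : 'I_N -> V).

Definition arc (i : 'I_N) : set V := [set k *: e i | k in [set k : R | 0 <= k]].

Definition grid (dx : R) : set V :=
  [set x | exists i : 'I_N, exists k : nat, x = (k%:R * dx) *: e i].

(* For unit vectors [e j], the condition [z = `|z| *: e i] says that [z] lies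
   on the arc [i]. For distinct unit vectors this index is unique if [z != 0];
   the vertex lies on every arc, and some index is then returned. *)
Definition arc_of (z : V) : option 'I_N := [pick i | z == `|z| *: e i].

(* Linear interpolation, at distance [r >= 0] from the vertex on the arc [i],
   between the nodes [k dx] and [(k + 1) dx] such that
   [k dx <= r < (k + 1) dx]. *)
Definition arc_interp (dx : R) (v : V -> R) (i : 'I_N) (r : R) : R :=
  let k := Num.truncn (r / dx) in
  let lambda := r / dx - k%:R in
  (1 - lambda) * v ((k%:R * dx) *: e i) + lambda * v ((k.+1%:R * dx) *: e i).

(* Discrete functions are functions on [V] of which only the values on the grid
   matter. At the vertex the arc is irrelevant, since [arc_interp dx v i 0] is
   [v 0] for every [i]. The value 0 outside the junction is a dummy. *)
Definition interp (dx : R) (v : V -> R) (z : V) : R :=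
  if arc_of z is Some i then arc_interp dx v i `|z| else 0.

Variables (L : 'I_N -> R -> R -> R) (L0bar : R) (dt dx : R) (v : V -> R).

(* The pairs (j, a_j) made of an arc and a control leading away from the
   vertex. *)
Definition exit_controls : set ('I_N * R) := [set c | c.2 <= 0].

(* [inf] is the infimum of a set of real numbers. All the sets below are
   nonempty if [0 < N], and bounded from below if [v] is bounded on the grid
   and the Lagrangians are convex and superlinear. *)
Definition scheme_vertex : R :=
  inf [set inf [set interp dx v (- (dt - s0) * c.2 *: e c.1)
                    + (dt - s0) * L c.1 0 c.2 + s0 * L0bar
               | c in exit_controls]
      | s0 in `[0, dt]%classic].

Definition scheme_stay (i : 'I_N) (x : V) : R :=
  inf [set interp dx v (x - (a * dt) *: e i) + dt * L i `|x| a
      | a in [set a : R | a < `|x| / dt]].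

Definition scheme_cross (i : 'I_N) (x : V) : R :=
  inf [set inf [set inf [set
      let theta := dt - s0 - `|x| / a in
      interp dx v (- theta * c.2 *: e c.1) + theta * L c.1 0 c.2
      + s0 * L0bar + `|x| / a * L i `|x| a
    | c in exit_controls]
    | s0 in `[0, dt - `|x| / a]%classic]
    | a in [set a : R | `|x| / dt <= a]].

Definition scheme (x : V) : R :=
  if x == 0 then scheme_vertex
  else if arc_of x is Some i then Num.min (scheme_stay i x) (scheme_cross i x)
  else 0.

End Junction.

Section JunctionFacts.
Variables (R : realType) (V : normedModType R) (N : nat) (e : 'I_N -> V).
Hypotheses (e_unit : forall i, `|e i| = 1) (e_inj : injective e).

Lemma norm_arc i (r : R) : 0 <= r -> `|r *: e i| = r.
Proof. by move=> r0; rewrite normrZ e_unit mulr1 ger0_norm. Qed.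

Lemma arc_of_arc i z : arc e i z -> z != 0 -> arc_of e z = Some i.
Proof.
move=> [r /= r0 <-{z}] z0; have r_neq0 : r != 0.
  by apply: contraNneq z0 => ->; rewrite scale0r.
rewrite /arc_of norm_arc //; case: pickP => [j /eqP|/(_ i)]; last by rewrite eqxx.
by move/(scalerI r_neq0)/e_inj => ->.
Qed.

Lemma arc_interp0 dx (v : V -> R) i : arc_interp e dx v i 0 = v 0.
Proof.
by rewrite /arc_interp mul0r truncn0 subrr subr0 mul1r !mul0r scale0r addr0.
Qed.

Lemma interp_arc dx (v : V -> R) i (r : R) :
  0 <= r -> interp e dx v (r *: e i) = arc_interp e dx v i r.
Proof.
move=> r0; have [->|r_neq0] := eqVneq r 0; last first.
  rewrite /interp (@arc_of_arc i) ?norm_arc //; first by exists r.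
  by rewrite -normr_gt0 norm_arc // lt0r r_neq0.
rewrite arc_interp0 scale0r /interp /arc_of normr0.
case: pickP => [j _|/(_ i)]; first exact: arc_interp0.
by rewrite scale0r eqxx.
Qed.

Lemma interp_node dx (v : V -> R) i (k : nat) :
  0 < dx -> interp e dx v ((k%:R * dx) *: e i) = v ((k%:R * dx) *: e i).
Proof.
move=> dx0; rewrite interp_arc; last by rewrite mulr_ge0 // ltW.
by rewrite /arc_interp mulfK ?gt_eqF // natrK subrr subr0 mul1r mul0r addr0.
Qed.

End JunctionFacts.

(* Main.v *)
(* Both values are iterated infima, over the same control sets, of costs that
   increase with the discrete function, since interpolation is a convex
   combination of grid values. Monotonicity of the real-valued infimum needs
   the costs of the smaller function to be bounded below: a strictly convex
   superlinear Lagrangian is bounded below at each fixed position, all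
   durations lie in [0, dt], and the interpolation inherits the bound of the
   discrete function. *)
Require Import Defs.
From mathcomp Require Import all_boot all_order all_algebra.
From mathcomp Require Import ring lra.
From mathcomp Require Import all_classical all_reals all_analysis.
Import Order.TTheory GRing.Theory Num.Theory.
Import numFieldNormedType.Exports.
Local Open Scope classical_set_scope.
Local Open Scope ring_scope.
Set Implicit Arguments.
Unset Strict Implicit.
Unset Printing Implicit Defensive.

(** The real [inf] of a set without lower bound is a default value, so pointwise order alone does
    not suffice. The bound [m] makes the smaller infimum a genuine one. *)
Lemma le_inf_image (R : realType) (T : Type) (A : set T) (f g : T -> R) (m : R) :
  A !=set0 -> (forall x, A x -> m <= f x) -> (forall x, A x -> f x <= g x) ->
  inf [set f x | x in A] <= inf [set g x | x in A].
Proof.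
move=> [x0 Ax0] mf fg; apply: lb_le_inf; first by exists (g x0), x0.
move=> _ [x Ax <-]; apply: le_trans (fg _ Ax).
apply: ge_inf; last by exists x.
by exists m => _ [y Ay <-]; exact: mf.
Qed.

Lemma inf_image_ge (R : realType) (T : Type) (A : set T) (f : T -> R) (m : R) :
  A !=set0 -> (forall x, A x -> m <= f x) -> m <= inf [set f x | x in A].
Proof.
move=> [x0 Ax0] mf; apply: lb_le_inf; first by exists (f x0), x0.
by move=> _ [x Ax <-]; exact: mf.
Qed.

Lemma bounded_lower (R : realType) (V : normedModType R) (A : set V) (f : V -> R) :
  [bounded f x : R^o | x in A] ->
  exists2 B : R, 0 <= B & forall x, A x -> - B <= f x.
Proof.
(* Boundedness gives the estimate only for constants strictly above [B], whose sign is unknown. *)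
move=> [B [_ hB]]; exists (`|B| + 1) => [|x Ax]; first by rewrite addr_ge0.
have BB : B < `|B| + 1 by rewrite (le_lt_trans (ler_norm B)) // ltrDl.
by have := hB _ BB x Ax; rewrite /= ler_norml => /andP[].
Qed.

(** Superlinearity at level 0 makes the cost nonnegative for controls of modulus at least [M];
    convexity handles the remaining bounded range. *)
Lemma lagrangian_lower_bound (R : realType) (L : R -> R -> R) (x : R) :
  regular_lagrangian L -> superlinear_lagrangian L -> 0 <= x ->
  exists2 m : R, m <= 0 & forall a, m <= L x a.
Proof.
move=> [cvx _] sup x0; have [M M0 hM] := sup 0.
pose C := `|L x (M + 1)| + `|L x (M + 2)|.
have C0 : 0 <= C by rewrite addr_ge0.
(* The factor [2 * M + 2] exceeds the distance [d] from any [a > - M] to [M + 2]. *)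
have m0 : - (C * (2 * M + 2)) <= 0 by rewrite oppr_le0 mulr_ge0 //; lra.
exists (- (C * (2 * M + 2))) => // a.
have [Ma|aM] := leP M `|a|.
  have a0 : 0 < `|a| by exact: lt_le_trans Ma.
  by apply: (le_trans m0); have := hM x a x0 Ma; rewrite ler_pdivlMr // mul0r.
(* [M + 1] lies between [a] and [M + 2], so that convexity bounds [L x a] from
   below by the values at these two fixed points. *)
have /andP[Ma1 Ma2] : - M < a < M by rewrite -ltr_norml.
pose d := M + 2 - a.
have d0 : 0 < d by rewrite /d; lra.
have t0 : 0 < d^-1 by rewrite invr_gt0.
have t1 : d^-1 < 1 by rewrite invf_lt1 // /d; lra.
have aneq : a != M + 2 by rewrite lt_eqF //; lra.
have := cvx x x0 a (M + 2) d^-1 aneq t0 t1.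
have -> : d^-1 * a + (1 - d^-1) * (M + 2) = M + 1.
  have -> : a = M + 2 - d by rewrite /d; ring.
  by field; rewrite gt_eqF.
(* Clearing the weights bounds [L x a] from below by [d * L x (M + 1) - (d - 1) * L x (M + 2)],
   hence by [- (C * d)]. *)
rewrite -(ltr_pM2l d0).
have -> : d * (d^-1 * L x a + (1 - d^-1) * L x (M + 2)) =
          L x a + (d - 1) * L x (M + 2).
  by field; rewrite gt_eqF.
move=> h.
have h1 : - `|L x (M + 1)| <= L x (M + 1) by rewrite lerNl ler_normr lexx orbT.
have h2 : L x (M + 2) <= `|L x (M + 2)| by exact: ler_norm.
have h3 : d * - `|L x (M + 1)| <= d * L x (M + 1) by rewrite ler_wpM2l // ltW.
have h4 : (d - 1) * L x (M + 2) <= d * `|L x (M + 2)|.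
  apply: (@le_trans _ _ ((d - 1) * `|L x (M + 2)|)).
    by rewrite ler_wpM2l // /d; lra.
  by rewrite ler_wpM2r // /d; lra.
have h5 : C * d <= C * (2 * M + 2) by rewrite ler_wpM2l // /d; lra.
by move: h5; rewrite {1}/C mulrDl; lra.
Qed.

Lemma lagrangian_family_lower_bound (R : realType) (N : nat)
    (L : 'I_N -> R -> R -> R) (x : R) :
  (forall i, regular_lagrangian (L i)) ->
  (forall i, superlinear_lagrangian (L i)) -> 0 <= x ->
  exists2 m : R, m <= 0 & forall i a, m <= L i x a.
Proof.
move=> A1 A2 x0.
have /choice[f hf] : forall i, exists m : R, m <= 0 /\ forall a, m <= L i x a.
  move=> i; have [m m0 hm] := lagrangian_lower_bound (A1 i) (A2 i) x0.
  by exists m.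
have f0 i : f i <= 0 by case: (hf i).
(* A sum of nonpositive numbers lies below each of its terms. *)
exists (\sum_i f i) => [|i a]; first exact: sumr_le0.
case: (hf i) => _ /(_ a); apply: le_trans.
by rewrite (bigD1 i) //= gerDl sumr_le0.
Qed.

(** As [m <= 0], the longest duration [T] is the worst case; this frees the bound from the duration
    [t], which varies with the controls. *)
Lemma mulr_ge_lower (R : realDomainType) (T t m l : R) :
  0 <= t -> t <= T -> m <= 0 -> m <= l -> T * m <= t * l.
Proof.
move=> t0 tT m0 ml; apply: (@le_trans _ _ (t * m)); last exact: ler_wpM2l.
exact: ler_wnM2r.
Qed.

Section Interpolation.
Variables (R : realType) (V : normedModType R) (N : nat) (e : 'I_N -> V).
Variables (dx : R) (dx_gt0 : 0 < dx).

Lemma le_interp (v1 v2 : V -> R) (z : V) :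
  (forall x, grid e dx x -> v1 x <= v2 x) ->
  interp e dx v1 z <= interp e dx v2 z.
Proof.
move=> v12; rewrite /interp; case: arc_of => // i; rewrite /arc_interp.
have r0 : 0 <= `|z| / dx by rewrite divr_ge0 // ltW.
(* Truncation places both interpolation weights in [0, 1]. *)
have /andP[k1 k2] := truncn_itv r0.
apply: lerD; apply: ler_wpM2l.
- by rewrite -natr1 in k2; lra.
- by apply: v12; exists i, (Num.truncn (`|z| / dx)).
- by lra.
- by apply: v12; exists i, (Num.truncn (`|z| / dx)).+1.
Qed.

(** Comparison with the constant function [- B], whose interpolation is [- B] on the junction and
    the dummy 0 elsewhere; the latter calls for [0 <= B]. *)
Lemma interp_ge (v : V -> R) (B : R) (z : V) : 0 <= B ->
  (forall x, grid e dx x -> - B <= v x) -> - B <= interp e dx v z.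
Proof.
move=> B0 vB; apply: le_trans (le_interp z vB).
rewrite /interp; case: arc_of => [i|]; last by rewrite oppr_le0.
by rewrite /arc_interp -mulrDl subrK mul1r.
Qed.

End Interpolation.

Section Monotone.
Variables (R : realType) (V : normedModType R) (N : nat) (e : 'I_N -> V).
Hypothesis N_gt0 : (0 < N)%N.
Variables (L : 'I_N -> R -> R -> R) (L0bar : R).
Hypothesis L_regular : forall i, regular_lagrangian (L i).
Hypothesis L_superlinear : forall i, superlinear_lagrangian (L i).
Variables (dt dx : R).
Hypotheses (dt_gt0 : 0 < dt) (dx_gt0 : 0 < dx).
Variables (v1 v2 : V -> R).
Hypothesis v1_bounded : [bounded v1 x : R^o | x in grid e dx].
Hypothesis v12 : forall x, grid e dx x -> v1 x <= v2 x.

Lemma exit_controls_neq0 : @exit_controls R N !=set0.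
Proof. by exists (Ordinal N_gt0, 0); rewrite /exit_controls /=. Qed.

Lemma le_scheme_vertex :
  scheme_vertex e L L0bar dt dx v1 <= scheme_vertex e L L0bar dt dx v2.
Proof.
have [B B0 vB] := bounded_lower v1_bounded.
have [m m0 hm] := lagrangian_family_lower_bound L_regular L_superlinear (lexx 0).
(* One bound, uniform in [s] and [c], serves both nested infima. *)
have s_ge (s : R) : s \in `[0, dt] -> forall c : 'I_N * R,
    - B + dt * m + dt * - `|L0bar| <=
    interp e dx v1 (- (dt - s) * c.2 *: e c.1)
    + (dt - s) * L c.1 0 c.2 + s * L0bar.
  rewrite in_itv /= => /andP[s0 sdt] c.
  apply: lerD; first apply: lerD.
  - exact: interp_ge vB.
  - by apply: mulr_ge_lower => //; lra.
  - by apply: mulr_ge_lower; rewrite ?oppr_le0 // lerNl ler_normr lexx orbT.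
apply: (@le_inf_image _ _ _ _ _ (- B + dt * m + dt * - `|L0bar|)).
- by exists 0; rewrite /= in_itv /= lexx ltW.
- by move=> s hs; apply: inf_image_ge exit_controls_neq0 _ => c _; exact: s_ge.
move=> s hs; apply: (le_inf_image exit_controls_neq0 (fun c _ => s_ge s hs c)).
by move=> c _; rewrite !lerD2r le_interp.
Qed.

Lemma le_scheme_stay (i : 'I_N) (x : V) :
  scheme_stay e L dt dx v1 i x <= scheme_stay e L dt dx v2 i x.
Proof.
have [B B0 vB] := bounded_lower v1_bounded.
have [m m0 hm] :=
  lagrangian_lower_bound (L_regular i) (L_superlinear i) (normr_ge0 x).
apply: (@le_inf_image _ _ _ _ _ (- B + dt * m)).
- by exists (`|x| / dt - 1); rewrite /= ltrBlDr ltrDl.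
- by move=> a _; apply: lerD; [exact: interp_ge|rewrite ler_pM2l].
- by move=> a _; rewrite lerD2r le_interp.
Qed.

Lemma le_scheme_cross (i : 'I_N) (x : V) : x != 0 ->
  scheme_cross e L L0bar dt dx v1 i x <= scheme_cross e L L0bar dt dx v2 i x.
Proof.
rewrite -normr_gt0 => x0; have [B B0 vB] := bounded_lower v1_bounded.
have [m m0 hm] := lagrangian_family_lower_bound L_regular L_superlinear (lexx 0).
have [m' m'0 hm'] :=
  lagrangian_lower_bound (L_regular i) (L_superlinear i) (normr_ge0 x).
(* As [x] is not the vertex, admissible controls are positive and reach the vertex within [dt]. *)
have time_le a : `|x| / dt <= a -> 0 <= `|x| / a /\ `|x| / a <= dt.
  move=> xa; have a0 : 0 < a by apply: lt_le_trans xa; rewrite divr_gt0.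
  split; first by rewrite divr_ge0 // ltW.
  by rewrite ler_pdivrMr // mulrC -ler_pdivrMr.
have itv_neq0 a : `|x| / dt <= a -> `[0, dt - `|x| / a]%classic !=set0.
  by move=> /time_le[_ xa]; exists 0; rewrite /= in_itv /= lexx subr_ge0.
(* The summands bound, in order, the interpolated value, the exit cost, the waiting cost and the
   cost of reaching the vertex. *)
set b := - B + dt * m + dt * - `|L0bar| + dt * m'.
have s_ge a s : `|x| / dt <= a -> s \in `[0, dt - `|x| / a] ->
    forall c : 'I_N * R,
    b <= interp e dx v1 (- (dt - s - `|x| / a) * c.2 *: e c.1)
         + (dt - s - `|x| / a) * L c.1 0 c.2
         + s * L0bar + `|x| / a * L i `|x| a.
  move=> /time_le[xa0 xadt]; rewrite in_itv /= => /andP[s0 sdt] c.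
  apply: lerD; last exact: mulr_ge_lower.
  apply: lerD; first apply: lerD.
  - exact: interp_ge vB.
  - by apply: mulr_ge_lower => //; lra.
  - apply: mulr_ge_lower; rewrite ?oppr_le0 //; first by lra.
    by rewrite lerNl ler_normr lexx orbT.
apply: (@le_inf_image _ _ _ _ _ b).
- by exists (`|x| / dt) => /=.
- move=> a ha; apply: inf_image_ge (itv_neq0 a ha) _ => s hs.
  by apply: inf_image_ge exit_controls_neq0 _ => c _; exact: s_ge.
move=> a ha; apply: (@le_inf_image _ _ _ _ _ b); first exact: itv_neq0.
  move=> s hs.
  by apply: inf_image_ge exit_controls_neq0 _ => c _; exact: s_ge.
move=> s hs.
apply: (le_inf_image exit_controls_neq0 (fun c _ => s_ge a s ha hs c)).
by move=> c _; rewrite !lerD2r le_interp.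
Qed.

End Monotone.

Theorem proposition3 (R : realType) (V : normedModType R)
    (N : nat) (hN : (0 < N)%N)
    (e : 'I_N -> V) (e_inj : injective e) (e_unit : forall i, `|e i| = 1)
    (L : 'I_N -> R -> R -> R) (L0bar : R)
    (A1 : forall i, regular_lagrangian (L i))
    (A2 : forall i, superlinear_lagrangian (L i))
    (dt dx : R) (dt_gt0 : 0 < dt) (dx_gt0 : 0 < dx)
    (v1 v2 : V -> R)
    (v1_bounded : [bounded v1 x : R^o | x in grid e dx])
    (v2_bounded : [bounded v2 x : R^o | x in grid e dx])
    (v12 : forall x, grid e dx x -> v1 x <= v2 x) :
  forall x, grid e dx x ->
    scheme e L L0bar dt dx v1 x <= scheme e L L0bar dt dx v2 x.
Proof.
move=> x _; rewrite /scheme; have [_|x0] := eqVneq x 0.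
  exact: le_scheme_vertex.
(* The arc depends on [x] alone, so both schemes take the same branch. *)
case: arc_of => // i.
by apply: le_min2; [exact: le_scheme_stay|exact: le_scheme_cross].
Qed.
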